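(* For any $\theta\in(0,\frac{\pi}{2})$, the first Rayleigh quotient $$\lambda_1(\theta)=\inf_{\substack{\psi\in H^1(\Omega^+_\theta)\setminus\{0\}\\ \psi=0\text{ on }\partial_{\mathsf{Dir}}\Omega^+_\theta}}\ \frac{\|\nabla\psi\|^2_{L^2(\Omega^+_\theta)}}{\|\psi\|^2_{L^2(\Omega^+_\theta)}}$$ satisfies $\lambda_1(\theta)<1$.
   Context: For $\theta\in(0,\frac{\pi}{2})$ the broken guide is $$\Omega_\theta=\Big\{(x_1,x_2)\in\mathbb{R}^2:\ x_1\tan\theta<|x_2|<\Big(x_1+\frac{\pi}{\sin\theta}\Big)\tan\theta\Big\},$$ the half-guide is $\Omega^+_\theta=\{(x_1,x_2)\in\Omega_\theta:\ x_2>0\}$, and $\partial_{\mathsf{Dir}}\Omega^+_\theta=\partial\Omega_\theta\cap\partial\Omega^+_\theta$ is the Dirichlet part of its boundary. The condition $\psi=0$ on $\partial_{\mathsf{Dir}}\Omega^+_\theta$ is understood in the sense of traces. *)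

(* Defs.v *)
From HB Require Import structures.
From mathcomp Require Import all_boot all_order all_algebra.
From mathcomp Require Import all_classical all_reals all_analysis.

Set Implicit Arguments.
Unset Strict Implicit.
Unset Printing Implicit Defensive.

Import Order.TTheory GRing.Theory Num.Theory.
Import numFieldNormedType.Exports.

Local Open Scope classical_set_scope.
Local Open Scope ring_scope.

(** The plane is [R * R]. Its norm in the library is the sup norm; only its
    topology and its linear structure are used here. *)

Definition leb2 (R : realType) :
    {measure set (measurableTypeR R * measurableTypeR R) -> \bar R} :=
  (@lebesgue_measure R \x @lebesgue_measure R)%E.

Definition boundary (T : topologicalType) (A : set T) : set T :=
  closure A `\` interior A.

Definition guide (R : realType) (theta : R) : set (R * R) :=
  [set x | x.1 * tan theta < `|x.2| < (x.1 + pi / sin theta) * tan theta].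

Definition half_guide (R : realType) (theta : R) : set (R * R) :=
  [set x | guide theta x /\ 0 < x.2].

Definition dir_boundary (R : realType) (theta : R) : set (R * R) :=
  boundary (guide theta) `&` boundary (half_guide theta).

Fixpoint Ck (R : realType) (k : nat) (f : R * R -> R) : Prop :=
  if k is k'.+1 then
    continuous f /\
    forall e : R * R, e = (1, 0) \/ e = (0, 1) ->
      (forall x, derivable f x e) /\ Ck k' (fun x => 'D_e f x)
  else continuous f.

Definition test_function (R : realType) (W : set (R * R))
    (phi : R * R -> R) : Prop :=
  [/\ forall k, Ck k phi,
      compact (closure [set x | phi x != 0]) &
      closure [set x | phi x != 0] `<=` W].

Definition sqnorm (R : realType) (W : set (R * R)) (f : R * R -> R) : \bar R :=
  (\int[@leb2 R]_(x in W) ((f x) ^+ 2)%:E)%E.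

(** The squared L^2 norm of a vector field, for the Euclidean norm. *)
Definition vsqnorm (R : realType) (W : set (R * R))
    (G : R * R -> R * R) : \bar R :=
  (\int[@leb2 R]_(x in W) ((G x).1 ^+ 2 + (G x).2 ^+ 2)%:E)%E.

Definition inL2 (R : realType) (W : set (R * R)) (f : R * R -> R) : Prop :=
  measurable_fun W f /\ (sqnorm W f < +oo)%E.

Definition weak_partial (R : realType) (W : set (R * R)) (e : R * R)
    (f g : R * R -> R) : Prop :=
  forall phi, test_function W phi ->
    (\int[@leb2 R]_(x in W) (f x * 'D_e phi x)%:E =
     - \int[@leb2 R]_(x in W) (g x * phi x)%:E)%E.

(** [inH1 W f G]: f is in H^1(W) and its weak gradient is G, which is in L^2(W)
    and determined almost everywhere on W by f. *)
Definition inH1 (R : realType) (W : set (R * R)) (f : R * R -> R)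
    (G : R * R -> R * R) : Prop :=
  [/\ inL2 W f, inL2 W (fun x => (G x).1), inL2 W (fun x => (G x).2),
      weak_partial W (1, 0) f (fun x => (G x).1) &
      weak_partial W (0, 1) f (fun x => (G x).2)].

(** The Dirichlet boundary consists of two parallel half-lines of direction
    (cos theta, sin theta), issued from (0, 0) and from (- pi / sin theta, 0).
    These are the unit speed parametrizations, over t in R, of the lines that
    carry them. *)
Definition dir_line (R : realType) (theta : R) (outer : bool) (t : R) : R * R :=
  ((if outer then - (pi / sin theta) else 0) + t * cos theta, t * sin theta).

(** The parameters t for which the point lies on the Dirichlet boundary. *)
Definition dir_param (R : realType) (theta : R) (outer : bool) : set R :=
  dir_line theta outer @^-1` dir_boundary theta.

(** The squared norm in L^2 of the Dirichlet boundary, for arc length. *)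
Definition dir_sqnorm (R : realType) (theta : R) (g : R * R -> R) : \bar R :=
  let sqnorm_on outer :=
    (\int[@lebesgue_measure R]_(t in dir_param theta outer)
      ((g (dir_line theta outer t)) ^+ 2)%:E)%E in
  (sqnorm_on false + sqnorm_on true)%E.

Definition dir_measurable (R : realType) (theta : R) (g : R * R -> R) : Prop :=
  forall outer, measurable_fun (dir_param theta outer)
                  (g \o dir_line theta outer).

(** The trace operator is the continuous extension to H^1 of the restriction
    to the boundary, defined on the functions of H^1 that are continuous up to
    the boundary. Hence g is the trace of f when f is the limit in H^1 of such
    functions, whose restrictions converge to g in L^2 of the Dirichlet
    boundary. *)
Definition has_dir_trace (R : realType) (theta : R) (f : R * R -> R)
    (G : R * R -> R * R) (g : R * R -> R) : Prop :=
  dir_measurable theta g /\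
  exists (phi : nat -> R * R -> R) (Phi : nat -> R * R -> R * R),
    [/\ forall n, inH1 (half_guide theta) (phi n) (Phi n) /\
                  {within closure (half_guide theta), continuous (phi n)},
        (fun n => sqnorm (half_guide theta) (fun x => phi n x - f x))
          @ \oo --> 0%E,
        (fun n => vsqnorm (half_guide theta) (fun x => Phi n x - G x))
          @ \oo --> 0%E &
        (fun n => dir_sqnorm theta (fun x => phi n x - g x)) @ \oo --> 0%E].

(** [admissible theta f G]: f is a nonzero element of H^1 of the half-guide,
    with weak gradient G and with zero trace on the Dirichlet boundary. *)
Definition admissible (R : realType) (theta : R) (f : R * R -> R)
    (G : R * R -> R * R) : Prop :=
  [/\ inH1 (half_guide theta) f G,
      ~ {ae @leb2 R, forall x, half_guide theta x -> f x = 0} &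
      has_dir_trace theta f G (cst 0)].

(** The infimum is taken in the extended reals; [fine] is applied to finite
    quantities, as f and G are square integrable. *)
Definition lambda1 (R : realType) (theta : R) : \bar R :=
  ereal_inf [set q | exists (f : R * R -> R) (G : R * R -> R * R),
    admissible theta f G /\
    q = (fine (vsqnorm (half_guide theta) G) /
         fine (sqnorm (half_guide theta) f))%:E].

(* Main.v *)
Require Import Defs.
From mathcomp Require Import all_boot all_order all_algebra.
From mathcomp Require Import all_classical all_reals all_analysis.
From mathcomp Require Import measurable_realfun.
From mathcomp Require Import ring lra.
Import Order.TTheory GRing.Theory Num.Theory.
Import numFieldNormedType.Exports.
Local Open Scope classical_set_scope.
Local Open Scope ring_scope.

(** Let c = cos theta, s = sin theta. In the coordinates
    tau = c * x2 - s * x1 (the distance to the inner Dirichlet line) and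
    y = x2, the half-guide is the half-strip 0 < tau < pi, 0 < y
    ([half_guideE]), the Dirichlet boundary is carried by the lines tau = 0
    and tau = pi, dx1 dx2 = dtau dy / s and, for psi = F(tau, y),
    |grad psi|^2 = F_tau^2 + 2 * c * F_tau * F_y + F_y^2.

    The threshold 1 is the energy of the transverse mode sin tau, which solves
    - Laplace(psi) = psi but, as c <> 0, violates the Neumann condition on
    y = 0: hence a correction near y = 0 lowers the energy at first order.
    Explicitly, take
      F = exp(- d * y) * sin tau + b * exp(- y) * sin (2 * tau).
    Its Rayleigh quotient is computed exactly, and
      s * (||grad F||^2 - ||F||^2)
        = pi / 2 * (d / 2 + 2 * b^2) - 8 / 3 * c * b * (1 - d) / (1 + d).
    The term linear in b is the contribution of y = 0; it dominates as soon as
    b is small and d = b^2, and b = c / 4 is small enough.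

    The computation is done once, by [sqnorm_mode]: F and its two partial
    derivatives all belong to the family [mode]. Tonelli's theorem reduces the
    square norm to an integral over tau ([integral_wave_sq]) and one over y
    ([integral_expR_comb]). The function F is admissible because it is C^1 on
    the whole plane, so that its classical partial derivatives are weak ones
    ([weak_partial_classical]), and because it vanishes identically on the two
    lines, so that the constant sequence F exhibits its zero trace. *)

(** * Continuous functions on the plane *)

Lemma continuous_slice1 {R : realType} (f : R * R -> R) (b : R) :
  continuous f -> continuous (fun x : R => f (x, b)).
Proof.
move=> cf x.
apply: (@continuous2_cvg _ _ _ _ _ _ id (fun=> b) (fun x y => f (x, y))).
- by rewrite (_ : (fun z => _) = f); [exact: cf|apply/funext => -[]].
- exact: cvg_id.
- exact: cvg_cst.
Qed.

Lemma continuous_slice2 {R : realType} (f : R * R -> R) (a : R) :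
  continuous f -> continuous (fun y : R => f (a, y)).
Proof.
move=> cf y.
apply: (@continuous2_cvg _ _ _ _ _ _ (fun=> a) id (fun x y => f (x, y))).
- by rewrite (_ : (fun z => _) = f); [exact: cf|apply/funext => -[]].
- exact: cvg_cst.
- exact: cvg_id.
Qed.

(** Measurability is for the product sigma-algebra. A continuous f is the
    pointwise limit of the functions obtained by rounding the first coordinate
    down to a multiple of 1 / n.+1; each of those is, on each of countably many
    vertical strips, a continuous function of the second coordinate alone. *)
Lemma continuous_measurable_plane {R : realType} (f : R * R -> R) :
  continuous f ->
  measurable_fun (setT : set (measurableTypeR R * measurableTypeR R)) f.
Proof.
move=> cf.
pose step (n : nat) (x : R) : R := (Num.floor (x * n.+1%:R))%:~R / n.+1%:R.
pose fn (n : nat) (x : measurableTypeR R * measurableTypeR R) : R :=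
  f (step n x.1, x.2).
have fcvg (x y : R) : f (step n x, y) @[n --> \oo] --> f (x, y).
  apply: (cvg_comp (step^~ x) (fun x => f (x, y))); last first.
    exact: continuous_slice1.
  apply: (@squeeze_cvgr _ _ _ _ (fun n => x - harmonic n) (cst x)).
  - near=> n; have /andP[l u] := floor_itv (x * n.+1%:R).
    rewrite /step /harmonic /= ler_pdivrMr ?ltr0n// l andbT.
    rewrite ler_pdivlMr ?ltr0n// mulrBl mulVf ?pnatr_eq0//.
    by rewrite lerBlDr ltW// -(intrD _ _ 1).
  - rewrite -[X in _ --> X]subr0.
    by apply: cvgB; [exact: cvg_cst|exact: cvg_harmonic].
  - exact: cvg_cst.
apply: (@measurable_fun_cvg _ _ _ _ fn); last first.
  by move=> [x y] _; exact: fcvg.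
move=> n _ Y mY; rewrite setTI.
rewrite (_ : fn n @^-1` Y = \bigcup_(k : int)
   (`[k%:~R / n.+1%:R, (k + 1)%:~R / n.+1%:R[%classic `*`
     [set y | Y (f (k%:~R / n.+1%:R, y))])); last first.
  apply/seteqP; split=> [[x y] Yx|[x y] [k _] [/= xk]].
    exists (Num.floor (x * n.+1%:R)) => //; split=> //=.
    have := floor_itv (x * n.+1%:R).
    by rewrite in_itv /= ler_pdivrMr ?ltr0n// ltr_pdivlMr ?ltr0n.
  rewrite in_itv /= ler_pdivrMr ?ltr0n// ltr_pdivlMr ?ltr0n// in xk.
  by rewrite /fn /step /= (floor_def xk).
apply: countable_bigcupT_measurable => // k.
apply: measurableX => //.
rewrite -[X in measurable X]setTI.
have mg : measurable_fun setT (fun y : R => f (k%:~R / n.+1%:R, y)).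
  by apply: continuous_measurable_fun; exact: continuous_slice2.
exact: mg.
Unshelve. all: by end_near. Qed.

Lemma measurable_sq_plane {R : realType} (f : R * R -> R)
    (D : set (measurableTypeR R * measurableTypeR R)) :
  continuous f -> measurable_fun D (fun x => (f x ^+ 2)%:E).
Proof.
move=> cf; apply/measurable_EFinP; apply: measurable_funTS.
by apply: measurable_funX; exact: continuous_measurable_plane.
Qed.

Lemma integrable_compact_support {R : realType} (k : R * R -> R) (M : R) :
  continuous k -> (forall x, M < `|x| -> k x = 0) ->
  (@leb2 R).-integrable setT (EFin \o k).
Proof.
move=> ck kM; pose B : set R := `[- M, M]%classic.
(* The norm of the plane is the sup norm, whose balls are squares. *)
have Bk x : ~ (B `*` B) x -> k x = 0.
  move=> nBx; apply: kM; rewrite ltNge; apply/negP.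
  rewrite prod_normE /= ge_max => /andP[x1 x2].
  by apply: nBx; split; rewrite /B /= in_itv /= -ler_norml.
have mB : measurable (B `*` B : set (measurableTypeR R * measurableTypeR R)).
  by apply: measurableX; exact: measurable_itv.
have -> : EFin \o k = (EFin \o k) \_ (B `*` B).
  apply/funext => x; rewrite patchE; case: ifPn => // /negP.
  by rewrite inE => /Bk /= ->.
apply/(integrable_restrict _ _ _) => //; rewrite setTI.
apply: measurable_bounded_integrable => //.
- have -> : leb2 R (B `*` B) = (@lebesgue_measure R B * @lebesgue_measure R B)%E.
    by apply: product_measure1E; exact: measurable_itv.
  rewrite /B lebesgue_measure_itv /=; case: ifPn => _; last by rewrite mule0 ltry.
  by rewrite -EFinB -EFinM ltry.
- by apply: measurable_funTS; exact: continuous_measurable_plane.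
- have : compact (k @` (B `*` B)).
    apply: continuous_compact; first exact: continuous_subspaceT.
    by apply: compact_setX; exact: segment_compact.
  move=> /compact_bounded [N [Nr kN]]; exists N; split=> // L NL x Bx.
  by apply: (kN L NL); exists x.
Qed.

(** * Classical derivatives are weak derivatives *)

(** The two difference quotients are the same function. *)
Lemma is_derive_slice1 {R : realType} (f : R * R -> R) (x y df : R) :
  is_derive (x, y) (1, 0) f df <-> is_derive x (1 : R) (fun z => f (z, y)) df.
Proof.
have E (h : R) : h *: (1, 0) + (x, y) = (h *: (1 : R) + x, y) :> R * R.
  by apply/pair_equal_spec; split => //=; rewrite scaler0 add0r.
have EF : (fun h : R => h^-1 *: ((f \o shift (x, y)) (h *: (1, 0)) - f (x, y))) =
    (fun h : R =>
       h^-1 *: (((fun z => f (z, y)) \o shift x) (h *: (1 : R)) - f (x, y))).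
  by apply/funext => h; rewrite /= E.
by split=> -[d dE]; split; move: d dE; rewrite /derivable /derive EF.
Qed.

Lemma is_derive_slice2 {R : realType} (f : R * R -> R) (x y df : R) :
  is_derive (x, y) (0, 1) f df <-> is_derive y (1 : R) (fun z => f (x, z)) df.
Proof.
have E (h : R) : h *: (0, 1) + (x, y) = (x, h *: (1 : R) + y) :> R * R.
  by apply/pair_equal_spec; split => //=; rewrite scaler0 add0r.
have EF : (fun h : R => h^-1 *: ((f \o shift (x, y)) (h *: (0, 1)) - f (x, y))) =
    (fun h : R =>
       h^-1 *: (((fun z => f (x, z)) \o shift y) (h *: (1 : R)) - f (x, y))).
  by apply/funext => h; rewrite /= E.
by split=> -[d dE]; split; move: d dE; rewrite /derivable /derive EF.
Qed.

Lemma integral_derive_compact_support {R : realType} (h h' : R -> R) (M : R) :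
  (forall x, is_derive x (1 : R) h (h' x)) -> continuous h' ->
  (forall x, M < `|x| -> h x = 0) -> (forall x, M < `|x| -> h' x = 0) ->
  (\int[@lebesgue_measure R]_x (h' x)%:E = 0)%E.
Proof.
move=> dh ch' hM h'M.
(* Even if M < 0, this gives a nontrivial interval with h = 0 at both ends. *)
pose A := `|M| + 1.
have A0 : 0 < A by rewrite ltr_wpDl.
have MA : M < `|A|.
  by rewrite (ger0_norm (ltW A0)) /A (le_lt_trans (ler_norm M))// ltrDl.
have ch : continuous h.
  move=> x; apply: differentiable_continuous; apply/derivable1_diffP.
  by case: (dh x).
have <- : (\int[@lebesgue_measure R]_(x in `[(- A)%R, A]) (h' x)%:E = 0)%E.
  rewrite (@continuous_FTC2 _ h' h) //.
  - by rewrite !hM // ?normrN// -EFinB subrr.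
  - by rewrite gtrN.
  - exact: continuous_subspaceT.
  - split; first by move=> x _; case: (dh x).
    + exact/cvg_at_right_filter/ch.
    + exact/cvg_at_left_filter/ch.
  - by move=> x _; rewrite derive1E; exact: derive_val.
rewrite [RHS]integral_mkcond; apply: eq_integral => x _; rewrite patchE.
case: ifPn => // /negP; rewrite inE /= in_itv /= -ler_norml => /negP.
rewrite -ltNge => Ax; rewrite h'M// (lt_le_trans MA)// (ger0_norm (ltW A0)).
exact: ltW.
Qed.

(** By Fubini's theorem, integrating first along the direction e. *)
Lemma integral_partial_compact_support {R : realType} (e : R * R)
    (h h' : R * R -> R) (M : R) :
  e = (1, 0) \/ e = (0, 1) ->
  (forall x, is_derive x e h (h' x)) -> continuous h' ->
  (forall x, M < `|x| -> h x = 0) -> (forall x, M < `|x| -> h' x = 0) ->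
  (\int[@leb2 R]_x (h' x)%:E = 0)%E.
Proof.
move=> eE dh ch' hM h'M.
have ih' := integrable_compact_support h' M ch' h'M.
have normM1 (x y : R) : M < `|x| -> M < `|(x, y)|.
  by move=> Mx; rewrite prod_normE /= lt_max Mx.
have normM2 (x y : R) : M < `|y| -> M < `|(x, y)|.
  by move=> My; rewrite prod_normE /= lt_max My orbT.
case: eE dh => -> dh.
- have slice (y : R) : (\int[@lebesgue_measure R]_x (h' (x, y))%:E = 0)%E.
    apply: (@integral_derive_compact_support R (fun x : R => h (x, y))
      (fun x : R => h' (x, y)) M).
    + by move=> x; apply/is_derive_slice1; exact: dh.
    + exact: continuous_slice1.
    + by move=> x Mx; apply: hM; exact: normM1.
    + by move=> x Mx; apply: h'M; exact: normM1.
  rewrite -(integral21_prod_meas1 ih') integral0_eq// => y _.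
  exact: slice.
- have slice (x : R) : (\int[@lebesgue_measure R]_y (h' (x, y))%:E = 0)%E.
    apply: (@integral_derive_compact_support R (fun y : R => h (x, y))
      (fun y : R => h' (x, y)) M).
    + by move=> y; apply/is_derive_slice2; exact: dh.
    + exact: continuous_slice2.
    + by move=> y My; apply: hM; exact: normM2.
    + by move=> y My; apply: h'M; exact: normM2.
  rewrite -(integral12_prod_meas1 ih') integral0_eq// => x _.
  exact: slice.
Qed.

Lemma near_notin_support {R : realType} (phi : R * R -> R) (x : R * R) :
  ~ closure [set y | phi y != 0] x -> \forall y \near x, phi y = 0.
Proof.
move=> nx; have oK := closed_openC (@closed_closure _ [set y | phi y != 0]).
apply: filterS (open_nbhs_nbhs (conj oK nx)) => y nKy.
by apply: contrapT => /eqP py; apply: nKy; exact: subset_closure.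
Qed.

Lemma integral_zero_off {R : realType} (W : set (R * R)) (k : R * R -> R) :
  (forall x, ~ W x -> k x = 0) ->
  (\int[@leb2 R]_(x in W) (k x)%:E = \int[@leb2 R]_x (k x)%:E)%E.
Proof.
move=> kW; rewrite integral_mkcond; apply: eq_integral => x _.
by rewrite patchE; case: ifPn => // /negP; rewrite inE => /kW ->.
Qed.

(** The product of f and a test function phi extends by zero to a C^1 function
    of compact support on the plane, so the integral of its partial derivative
    is zero. *)
Lemma weak_partial_classical {R : realType} (W : set (R * R)) (e : R * R)
    (f g : R * R -> R) :
  e = (1, 0) \/ e = (0, 1) ->
  continuous f -> continuous g ->
  (forall x, is_derive x e f (g x)) ->
  weak_partial W e f g.
Proof.
move=> eE cf cg df phi [Cphi Kc KW].
pose K := closure [set x | phi x != 0].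
have [M KM] : exists M : R, forall x, M < `|x| -> ~ K x.
  have [N [Nr HN]] := compact_bounded Kc.
  exists (N + 1) => x xN Kx.
  have : `|x| <= N + 1 by apply: (HN (N + 1)); rewrite ?ltrDl.
  by rewrite leNgt xN.
have cphi : continuous phi by exact: (Cphi 0%N).
have [_ /(_ e eE)[dphi cDphi]] := Cphi 1%N.
have phi0 x : ~ K x -> phi x = 0.
  by move=> /near_notin_support /nbhs_singleton.
have Dphi0 x : ~ K x -> 'D_e phi x = 0.
  move=> /near_notin_support n0.
  by rewrite (near_eq_derive _ (g := cst 0)) ?derive_cst.
pose u x := f x * 'D_e phi x; pose v x := g x * phi x.
have cu : continuous u by move=> x; apply: cvgM; [exact: cf|exact: cDphi].
have cv : continuous v by move=> x; apply: cvgM; [exact: cg|exact: cphi].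
have u0 x : ~ K x -> u x = 0 by move=> /Dphi0; rewrite /u => ->; rewrite mulr0.
have v0 x : ~ K x -> v x = 0 by move=> /phi0; rewrite /v => ->; rewrite mulr0.
rewrite (integral_zero_off W u); last by move=> x nWx; apply: u0 => /KW.
rewrite (integral_zero_off W v); last by move=> x nWx; apply: v0 => /KW.
have iu : (@leb2 R).-integrable setT (EFin \o u).
  by apply: (integrable_compact_support _ M) => // x /KM /u0.
have iv : (@leb2 R).-integrable setT (EFin \o v).
  by apply: (integrable_compact_support _ M) => // x /KM /v0.
have : (\int[@leb2 R]_x ((EFin \o u) x + (EFin \o v) x) = 0)%E.
  apply: (integral_partial_compact_support e (fun x => f x * phi x)
    (fun x => u x + v x) M eE).
  - move=> x; have dp : is_derive x e phi ('D_e phi x) by split.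
    apply: (is_derive_eq (is_deriveM (df x) dp)).
    by rewrite /u /v /GRing.scale /=; ring.
  - by move=> x; apply: cvgD; [exact: cu|exact: cv].
  - by move=> x /KM /phi0 ->; rewrite mulr0.
  - by move=> x /KM Kx; rewrite u0// v0// addr0.
rewrite integralD //=.
have := integrable_fin_num measurableT iu.
have := integrable_fin_num measurableT iv.
move=> /= /fineK <- /fineK <-.
by rewrite -EFinD => -[] /eqP; rewrite addr_eq0 => /eqP ->.
Qed.

(** * The transverse integral *)

(** The derivative of p1 * sin + p2 * sin (2 * _), plus
    q1 * sin + q2 * sin (2 * _): this space contains the transverse profiles of
    the trial function and of both its partial derivatives. *)
Definition wave {R : realType} (p1 p2 q1 q2 t : R) : R :=
  p1 * cos t + 2 * p2 * cos (2 * t) + q1 * sin t + q2 * sin (2 * t).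

Lemma waveE {R : realType} (p1 p2 q1 q2 t : R) : wave p1 p2 q1 q2 t =
  p1 * cos t + 2 * p2 * (cos t ^+ 2 - sin t ^+ 2) + q1 * sin t
  + 2 * q2 * sin t * cos t.
Proof.
rewrite /wave !(mulr_natl t) sin_mulr2n cos_mulr2n.
have := cos2Dsin2 t; move: (sin t) (cos t) => S C h.
have -> : S ^+ 2 = 1 - C ^+ 2 by rewrite -h; ring.
ring.
Qed.

(** A primitive of the square of [wave], found term by term after expanding
    the square into the ten products of its four summands. *)
Definition wave_sq_prim {R : realType} (p1 p2 q1 q2 t : R) : R :=
  let S := sin t in let C := cos t in
  p1 ^+ 2 / 2 * (t + S * C) + 2 * p2 ^+ 2 * (t + S * C * (C ^+ 2 - S ^+ 2)) +
  q1 ^+ 2 / 2 * (t - S * C) + q2 ^+ 2 / 2 * (t - S * C * (C ^+ 2 - S ^+ 2)) +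
  4 * p1 * p2 * (S - 2 / 3 * S ^+ 3) + p1 * q1 * S ^+ 2
  - 4 / 3 * p1 * q2 * C ^+ 3 + 4 * p2 * q1 * (C - 2 / 3 * C ^+ 3)
  + 4 * p2 * q2 * (S ^+ 2 * C ^+ 2) + 4 / 3 * q1 * q2 * S ^+ 3.

Lemma is_derive_wave_sq_prim {R : realType} (p1 p2 q1 q2 t : R) :
  is_derive t 1 (wave_sq_prim p1 p2 q1 q2) (wave p1 p2 q1 q2 t ^+ 2).
Proof.
rewrite /wave_sq_prim; apply: is_derive_eq.
rewrite waveE /GRing.scale /=.
have := cos2Dsin2 t; move: (sin t) (cos t) => S C h.
have {}h : C ^+ 2 = 1 - S ^+ 2 by rewrite -h; ring.
by field: h.
Qed.

Lemma wave_sq_prim_0pi {R : realType} (p1 p2 q1 q2 : R) :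
  wave_sq_prim p1 p2 q1 q2 pi - wave_sq_prim p1 p2 q1 q2 0 =
  pi / 2 * (p1 ^+ 2 + 4 * p2 ^+ 2 + q1 ^+ 2 + q2 ^+ 2)
  + 8 / 3 * (p1 * q2 - p2 * q1).
Proof. by rewrite /wave_sq_prim sin0 cos0 sinpi cospi; field. Qed.

Lemma continuous_wave {R : realType} (p1 p2 q1 q2 : R) :
  continuous (wave p1 p2 q1 q2).
Proof.
move=> t; apply: differentiable_continuous; rewrite /wave.
by apply/derivable1_diffP.
Qed.

(** The integral is over a horizontal section of the half-guide, at height y
    when u = cos theta * y and s = sin theta: there u - s * x runs over the
    interval from 0 to pi. The last term, the only one that can be negative,
    is what couples the two transverse modes. *)
Lemma integral_wave_sq {R : realType} (p1 p2 q1 q2 s u : R) : 0 < s ->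
  (\int[@lebesgue_measure R]_(x in `]((u - pi) / s)%R, (u / s)%R[%classic)
     (wave p1 p2 q1 q2 (u - s * x) ^+ 2)%:E =
   (s^-1 * (pi / 2 * (p1 ^+ 2 + 4 * p2 ^+ 2 + q1 ^+ 2 + q2 ^+ 2)
            + 8 / 3 * (p1 * q2 - p2 * q1)))%:E)%E.
Proof.
move=> s0; pose g (y : R) : R := u - s * y.
pose f (x : R) : R := wave p1 p2 q1 q2 (g x) ^+ 2.
pose F (x : R) : R := - s^-1 * wave_sq_prim p1 p2 q1 q2 (g x).
have dg (x : R) : is_derive x (1 : R) g (- s).
  by rewrite /g; apply: is_derive_eq; rewrite /GRing.scale /=; ring.
have cg : continuous g.
  by move=> x; apply: cvgB; [exact: cvg_cst | apply: cvgMl_tmp; exact: cvg_id].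
have cf : continuous f.
  move=> x; apply: (@continuous_comp _ _ _
    (fun x => wave p1 p2 q1 q2 (g x)) (fun z : R => z ^+ 2)).
    by apply: continuous_comp; [exact: cg | exact: continuous_wave].
  exact: exprn_continuous.
have dF (x : R) : is_derive x (1 : R) F (f x).
  have dh := is_derive1_comp (is_derive_wave_sq_prim p1 p2 q1 q2 (g x)) (dg x).
  apply: (is_derive_eq (@is_deriveZ _ _ _ _ (- s^-1) _ _ _ dh)).
  by rewrite /f /GRing.scale /=; field; rewrite gt_eqF.
have cF : continuous F.
  move=> x; apply: differentiable_continuous; apply/derivable1_diffP.
  by case: (dF x).
rewrite -(@integral_itv_bndoo _ _ _ _ true false); last first.
  apply/measurable_EFinP; apply: measurable_funTS.
  exact: continuous_measurable_fun.
rewrite -[LHS]/(\int[@lebesgue_measure R]_(x in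
  `[((u - pi) / s)%R, (u / s)%R]) (f x)%:E)%E.
rewrite (@continuous_FTC2 _ f F) //.
- rewrite -EFinB; congr EFin; rewrite /F /g.
  have -> : u - s * ((u - pi) / s) = pi by field; rewrite gt_eqF.
  have -> : u - s * (u / s) = 0 by field; rewrite gt_eqF.
  by rewrite -wave_sq_prim_0pi; ring.
- by rewrite ltr_pM2r ?invr_gt0// ltrBlDr ltrDl pi_gt0.
- exact: continuous_subspaceT.
- split; first by move=> x _; case: (dF x).
  + exact/cvg_at_right_filter/cF.
  + exact/cvg_at_left_filter/cF.
- by move=> x _; rewrite derive1E; exact: derive_val.
Qed.

(** * The longitudinal integral *)

Lemma is_derive_expRM {R : realType} (a x : R) :
  is_derive x (1 : R) (fun y => expR (a * y)) (a * expR (a * x)).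
Proof.
have dg : is_derive x (1 : R) (fun y : R => a * y) a.
  by apply: is_derive_eq; rewrite /GRing.scale /=; ring.
apply: (is_derive_eq (is_derive1_comp (is_derive_expR (a * x)) dg)).
by rewrite mulrC.
Qed.

Lemma cvgy_expRNM {R : realType} (a : R) : 0 < a ->
  expR (- a * y) @[y --> +oo] --> 0.
Proof.
move=> a0.
rewrite (_ : (fun y => _) = (fun z => expR (- z)) \o (fun y => a * y)); last first.
  by apply/funext => y /=; rewrite mulNr.
apply: (cvg_comp _ _ _ (@cvgr_expR R)).
exact: gt0_cvgMry.
Qed.

(** The coefficients may have any sign; nonnegativity of the sum is what allows
    the fundamental theorem of calculus on an unbounded interval. *)
Lemma integral_expR_comb {R : realType} (d k c1 c2 c3 : R) : 0 < d -> 0 < k ->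
  let h (y : R) : R := c1 * expR (- d * y) ^+ 2 + c2 * expR (- k * y) ^+ 2
    + c3 * (expR (- d * y) * expR (- k * y)) in
  (forall y, 0 <= h y) ->
  (\int[@lebesgue_measure R]_(y in `]0%R, +oo[) (h y)%:E =
   (c1 / (2 * d) + c2 / (2 * k) + c3 / (d + k))%:E)%E.
Proof.
move=> d0 k0 h h0.
pose E (a y : R) : R := expR (- a * y).
pose H (y : R) : R := - (c1 / (2 * d)) * (E d y * E d y)
    - c2 / (2 * k) * (E k y * E k y) - c3 / (d + k) * (E d y * E k y).
have dE (a y : R) : is_derive y (1 : R) (E a) (- a * E a y).
  exact: is_derive_expRM.
have dk0 : d + k != 0 by rewrite gt_eqF// addr_gt0.
have dH (y : R) : is_derive y (1 : R) H (h y).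
  rewrite /H; apply: is_derive_eq; rewrite /h -!/(E _ _) /GRing.scale /=.
  by field; rewrite dk0 !gt_eqF.
have cH : continuous H.
  move=> x; apply: differentiable_continuous; apply/derivable1_diffP.
  by case: (dH x).
have cE (a : R) : continuous (E a).
  move=> x; apply: differentiable_continuous; apply/derivable1_diffP.
  by case: (dE a x).
have ch : continuous h.
  by move=> x; apply: cvgD; [apply: cvgD|];
    (apply: cvgM; [exact: cvg_cst|apply: cvgM; exact: cE]).
have H_lim : H y @[y --> +oo] --> 0.
  have lE (a : R) : 0 < a -> E a y @[y --> +oo] --> 0 by exact: cvgy_expRNM.
  (* The limit 0, in the shape of H, so that the limit laws apply. *)
  have e0 : 0 = - (c1 / (2 * d)) * (0 * 0) - c2 / (2 * k) * (0 * 0)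
     - c3 / (d + k) * (0 * 0) by ring.
  rewrite [X in _ --> X]e0.
  by apply: cvgB; [apply: cvgB|];
    (apply: cvgM; [exact: cvg_cst|apply: cvgM; exact: lE]).
rewrite (@integral_itv_obnd_cbnd _ 0 +oo%O (fun y => (h y)%:E)); last first.
  apply/measurable_EFinP; apply: measurable_funTS.
  exact: continuous_measurable_fun.
rewrite (@ge0_continuous_FTC2y _ h H 0 0) //.
- rewrite -EFinB; congr EFin; rewrite /H /E !mulr0 expR0.
  by field; rewrite dk0 !gt_eqF.
- exact: continuous_subspaceT.
- exact/cvg_at_right_filter/cH.
- by move=> x _; rewrite derive1E; exact: derive_val.
Qed.

(** * The half-guide and the trial functions *)

Lemma cos_gt0_acute {R : realType} (theta : R) :
  0 < theta < pi / 2 -> 0 < cos theta.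
Proof.
move=> /andP[t0 t2]; apply: cos_gt0_pihalf.
by rewrite t2 andbT (lt_trans _ t0)// oppr_lt0 divr_gt0 ?pi_gt0.
Qed.

Lemma half_guideE {R : realType} (theta : R) : 0 < theta < pi / 2 ->
  half_guide theta =
  [set x | 0 < x.2 /\ 0 < cos theta * x.2 - sin theta * x.1 < pi].
Proof.
move=> ht; have s0 := sin_gt0_pihalf ht; have c0 := cos_gt0_acute theta ht.
have outerE (x1 : R) : (x1 + pi / sin theta) * (sin theta / cos theta) =
    (x1 * sin theta + pi) / cos theta by field; rewrite !gt_eqF.
apply/seteqP; split=> x; rewrite /half_guide /guide /= /tan.
- move=> [/andP[+ +] x2]; rewrite gtr0_norm// mulrA ltr_pdivrMr// => l.
  rewrite outerE ltr_pdivlMr// => u; split=> //.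
  by apply/andP; split; lra.
- move=> [x2] /andP[u l]; split=> //.
  rewrite gtr0_norm// mulrA ltr_pdivrMr// outerE ltr_pdivlMr//.
  by apply/andP; split; lra.
Qed.

Lemma measurable_half_guide {R : realType} (theta : R) : 0 < theta < pi / 2 ->
  measurable (half_guide theta : set (measurableTypeR R * measurableTypeR R)).
Proof.
move=> ht.
have -> : half_guide theta = (fun x => x.2) @^-1` `]0, +oo[%classic `&`
    (fun x => cos theta * x.2 - sin theta * x.1) @^-1` `]0, pi[%classic.
  rewrite half_guideE//; apply/seteqP.
  by split=> x; rewrite /= !in_itv /= andbT => -[].
have m2 : measurable_fun (setT : set (measurableTypeR R * measurableTypeR R))
    (fun x => x.2 : R).
  by apply: continuous_measurable_plane => x; exact: cvg_snd.
have mt : measurable_fun (setT : set (measurableTypeR R * measurableTypeR R))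
    (fun x => cos theta * x.2 - sin theta * x.1 : R).
  apply: continuous_measurable_plane => x; apply: cvgB; apply: cvgM.
  - exact: cvg_cst.
  - exact: cvg_snd.
  - exact: cvg_cst.
  - exact: cvg_fst.
apply: measurableI; rewrite -[X in measurable X]setTI.
  by apply: m2 => //; exact: measurable_itv.
by apply: mt => //; exact: measurable_itv.
Qed.

(** The two transverse modes, evaluated at the distance to the inner Dirichlet
    line, decay in x2 at the rates d and k. *)
Definition mode {R : realType} (theta d k p1 p2 q1 q2 : R) (x : R * R) : R :=
  let u := expR (- d * x.2) in let v := expR (- k * x.2) in
  wave (p1 * u) (p2 * v) (q1 * u) (q2 * v)
    (cos theta * x.2 - sin theta * x.1).

Lemma continuous_mode {R : realType} (theta d k p1 p2 q1 q2 : R) :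
  continuous (mode theta d k p1 p2 q1 q2).
Proof.
have c1 : continuous (fst : R * R -> R) by move=> x; exact: cvg_fst.
have c2 : continuous (snd : R * R -> R) by move=> x; exact: cvg_snd.
have cl (a : R) : continuous (fun x : R * R => expR (a * x.2)).
  move=> x; apply: (@continuous_comp _ _ _ (fun x : R * R => a * x.2) expR).
    by apply: cvgM; [exact: cvg_cst|exact: c2].
  exact: continuous_expR.
have ct : continuous (fun x : R * R => cos theta * x.2 - sin theta * x.1).
  move=> x; apply: cvgB; apply: cvgM.
  - exact: cvg_cst.
  - exact: c2.
  - exact: cvg_cst.
  - exact: c1.
have ct2 : continuous
    (fun x : R * R => 2 * (cos theta * x.2 - sin theta * x.1)).
  by move=> x; apply: cvgM; [exact: cvg_cst|exact: ct].
move=> x; rewrite /mode /wave.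
have clM (a q : R) : continuous (fun x : R * R => q * expR (a * x.2)).
  by move=> z; apply: cvgM; [exact: cvg_cst|exact: cl].
apply: cvgD; [apply: cvgD; [apply: cvgD|]|]; apply: cvgM.
- exact: clM.
- exact: (continuous_comp (ct x) (@continuous_cos R _)).
- by apply: cvgM; [exact: cvg_cst|exact: clM].
- exact: (continuous_comp (ct2 x) (@continuous_cos R _)).
- exact: clM.
- exact: (continuous_comp (ct x) (@continuous_sin R _)).
- exact: clM.
- exact: (continuous_comp (ct2 x) (@continuous_sin R _)).
Qed.

Lemma sqnorm_mode {R : realType} (theta d k p1 p2 q1 q2 : R) :
  0 < theta < pi / 2 -> 0 < d -> 0 < k ->
  sqnorm (half_guide theta) (mode theta d k p1 p2 q1 q2) =
  ((sin theta)^-1 * (pi / 2 * ((p1 ^+ 2 + q1 ^+ 2) / (2 * d)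
      + (4 * p2 ^+ 2 + q2 ^+ 2) / (2 * k))
    + 8 / 3 * (p1 * q2 - p2 * q1) / (d + k)))%:E.
Proof.
move=> ht d0 k0; have s0 := sin_gt0_pihalf ht.
pose m := mode theta d k p1 p2 q1 q2.
(* The integral over the section of the half-guide at height y. *)
pose h (y : R) : R :=
  (sin theta)^-1 * (pi / 2 * (p1 ^+ 2 + q1 ^+ 2)) * expR (- d * y) ^+ 2
  + (sin theta)^-1 * (pi / 2 * (4 * p2 ^+ 2 + q2 ^+ 2)) * expR (- k * y) ^+ 2
  + (sin theta)^-1 * (8 / 3 * (p1 * q2 - p2 * q1))
      * (expR (- d * y) * expR (- k * y)).
have hE (y : R) : (\int[@lebesgue_measure R]_(x in
    `]((cos theta * y - pi) / sin theta)%R, (cos theta * y / sin theta)%R[%classic)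
    (m (x, y) ^+ 2)%:E = (h y)%:E)%E.
  by rewrite /m /mode /= integral_wave_sq//; congr EFin; rewrite /h; ring.
have h0 y : 0 <= h y.
  by rewrite -lee_fin -hE; apply: integral_ge0 => x _; rewrite lee_fin sqr_ge0.
have mW := measurable_half_guide theta ht.
rewrite /sqnorm integral_mkcond.
rewrite /leb2 fubini_tonelli2; last 2 first.
- apply/(measurable_restrict _ _ _).1 => //; rewrite setTI.
  by apply: measurable_sq_plane; exact: continuous_mode.
- by move=> x; rewrite patchE; case: ifPn => // _; rewrite lee_fin sqr_ge0.
transitivity (\int[@lebesgue_measure R]_(y in `]0%R, +oo[) (h y)%:E)%E.
  rewrite [RHS]integral_mkcond; apply: eq_integral => y _.
  rewrite patchE /fubini_G.
  case: ifPn => [|/negP]; rewrite inE /= in_itv /= andbT => y0.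
    rewrite -hE [RHS]integral_mkcond; apply: eq_integral => x _.
    rewrite !patchE half_guideE//; congr (if _ then _ else _).
    apply/idP/idP; rewrite !inE /= in_itv /= ltr_pdivrMr// ltr_pdivlMr//.
      by case=> _ /andP[? ?]; apply/andP; split; lra.
    by move=> /andP[? ?]; split=> //; apply/andP; split; lra.
  apply: integral0_eq => x _; rewrite patchE half_guideE//.
  by case: ifPn => //; rewrite inE /= => -[].
rewrite integral_expR_comb//; congr EFin.
by field; rewrite !gt_eqF// addr_gt0.
Qed.

Lemma inL2_mode {R : realType} (theta d k p1 p2 q1 q2 : R) :
  0 < theta < pi / 2 -> 0 < d -> 0 < k ->
  inL2 (half_guide theta) (mode theta d k p1 p2 q1 q2).
Proof.
move=> ht d0 k0; split; last by rewrite sqnorm_mode// ltry.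
apply: measurable_funTS; apply: continuous_measurable_plane.
exact: continuous_mode.
Qed.

Lemma is_derive_sin_affine {R : realType} (a b x : R) :
  is_derive x (1 : R) (fun y => sin (a + b * y)) (b * cos (a + b * x)).
Proof.
have dg : is_derive x (1 : R) (fun y : R => a + b * y) b.
  by apply: is_derive_eq; rewrite /GRing.scale /=; ring.
have h := @is_derive1_comp R sin (fun y : R => a + b * y) x _ _
  (is_derive_sin (a + b * x)) dg.
by apply: (is_derive_eq h); rewrite mulrC.
Qed.

Lemma is_derive1_mode {R : realType} (theta d k q1 q2 : R) (x : R * R) :
  is_derive x (1, 0) (mode theta d k 0 0 q1 q2)
   (mode theta d k (- sin theta * q1) (- sin theta * q2) 0 0 x).
Proof.
case: x => x y; apply/is_derive_slice1.
set u := expR (- d * y); set v := expR (- k * y).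
have d1 := is_derive_sin_affine (cos theta * y) (- sin theta) x.
have d2 := is_derive_sin_affine (2 * (cos theta * y)) (2 * - sin theta) x.
rewrite (_ : (fun z => _) = (fun z =>
   q1 * u * sin (cos theta * y + - sin theta * z) +
   q2 * v * sin (2 * (cos theta * y) + 2 * - sin theta * z))); last first.
  apply/funext => z; rewrite /mode /wave /= -/u -/v !(mul0r, mulr0, add0r).
  by congr (_ * sin _ + _ * sin _); ring.
apply: is_derive_eq; rewrite /mode /wave /GRing.scale /= -/u -/v.
have -> : cos theta * y + - sin theta * x = cos theta * y - sin theta * x by ring.
have -> : 2 * (cos theta * y) + 2 * - sin theta * x =
  2 * (cos theta * y - sin theta * x) by ring.
ring.
Qed.

Lemma is_derive2_mode {R : realType} (theta d k q1 q2 : R) (x : R * R) :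
  is_derive x (0, 1) (mode theta d k 0 0 q1 q2)
   (mode theta d k (cos theta * q1) (cos theta * q2) (- d * q1) (- k * q2) x).
Proof.
case: x => x y; apply/is_derive_slice2.
have d1 := is_derive_sin_affine (- sin theta * x) (cos theta) y.
have d2 := is_derive_sin_affine (2 * (- sin theta * x)) (2 * cos theta) y.
have du := is_derive_expRM (- d) y.
have dv := is_derive_expRM (- k) y.
rewrite (_ : (fun z => _) = (fun z =>
   q1 * (expR (- d * z) * sin (- sin theta * x + cos theta * z)) +
   q2 * (expR (- k * z) * sin (2 * (- sin theta * x) + 2 * cos theta * z))));
  last first.
  apply/funext => z; rewrite /mode /wave /= !(mul0r, mulr0, add0r) !mulrA.
  by congr (_ * sin _ + _ * sin _); ring.
apply: is_derive_eq; rewrite /mode /wave /GRing.scale /=.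
have -> : - sin theta * x + cos theta * y = cos theta * y - sin theta * x by ring.
have -> : 2 * (- sin theta * x) + 2 * cos theta * y =
  2 * (cos theta * y - sin theta * x) by ring.
ring.
Qed.

Lemma mode_dir_line {R : realType} (theta d k q1 q2 : R) (outer : bool) (t : R) :
  0 < theta < pi / 2 ->
  mode theta d k 0 0 q1 q2 (dir_line theta outer t) = 0.
Proof.
move=> ht; have s0 := sin_gt0_pihalf ht.
rewrite /mode waveE /dir_line /=.
have -> : cos theta * (t * sin theta)
    - sin theta * ((if outer then - (pi / sin theta) else 0) + t * cos theta)
    = (if outer then pi else 0).
  by case: outer; [field; rewrite gt_eqF|ring].
have -> : sin (if outer then pi else 0) = 0 :> R.
  by case: outer; rewrite ?sinpi ?sin0.
ring.
Qed.

Lemma inH1_mode {R : realType} (theta d k q1 q2 : R) :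
  0 < theta < pi / 2 -> 0 < d -> 0 < k ->
  inH1 (half_guide theta) (mode theta d k 0 0 q1 q2)
    (fun x => (mode theta d k (- sin theta * q1) (- sin theta * q2) 0 0 x,
      mode theta d k (cos theta * q1) (cos theta * q2) (- d * q1) (- k * q2) x)).
Proof.
move=> ht d0 k0; split.
- exact: inL2_mode.
- exact: inL2_mode.
- exact: inL2_mode.
- apply: weak_partial_classical; [by left|exact: continuous_mode..|].
  by move=> x; exact: is_derive1_mode.
- apply: weak_partial_classical; [by right|exact: continuous_mode..|].
  by move=> x; exact: is_derive2_mode.
Qed.

(** A continuous f serves as its own approximating sequence. *)
Lemma has_dir_trace0 {R : realType} (theta : R) (f : R * R -> R)
    (G : R * R -> R * R) :
  inH1 (half_guide theta) f G -> continuous f ->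
  (forall outer t, f (dir_line theta outer t) = 0) ->
  has_dir_trace theta f G (cst 0).
Proof.
move=> fH cf f0; split; first by move=> outer; exact: measurable_cst.
exists (fun=> f), (fun=> G); split.
- by move=> _; split=> //; exact: continuous_subspaceT.
- rewrite (_ : (fun=> _) = cst 0%E); first exact: cvg_cst.
  apply/funext => n /=; rewrite /sqnorm integral0_eq// => x _.
  by rewrite subrr expr0n.
- rewrite (_ : (fun=> _) = cst 0%E); first exact: cvg_cst.
  apply/funext => n /=; rewrite /vsqnorm integral0_eq// => x _.
  by rewrite /= !subrr expr0n addr0.
- rewrite (_ : (fun=> _) = cst 0%E); first exact: cvg_cst.
  apply/funext => n /=.
  by rewrite /dir_sqnorm !integral0_eq ?adde0// => t _;
    rewrite f0 subrr expr0n.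
Qed.

Theorem proposition4p1 (R : realType) (theta : R)
    (htheta : 0 < theta < pi / 2) :
  (lambda1 theta < 1%:E)%E.
Proof.
have s0 := sin_gt0_pihalf htheta; have c0 := cos_gt0_acute theta htheta.
pose b : R := cos theta / 4; pose d : R := b ^+ 2.
have b0 : 0 < b by rewrite divr_gt0.
have d0 : 0 < d by rewrite exprn_gt0.
pose f := mode theta d 1 0 0 1 b.
pose G1 := mode theta d 1 (- sin theta * 1) (- sin theta * b) 0 0.
pose G2 := mode theta d 1 (cos theta * 1) (cos theta * b) (- d * 1) (- 1 * b).
pose G x := (G1 x, G2 x).
have cf : continuous f by exact: continuous_mode.
have cG1 : continuous G1 by exact: continuous_mode.
have cG2 : continuous G2 by exact: continuous_mode.
pose Nf : R := (sin theta)^-1 * (pi / 2 * (1 / (2 * d) + b ^+ 2 / 2)).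
have fE : sqnorm (half_guide theta) f = Nf%:E.
  rewrite /f sqnorm_mode//; congr EFin; rewrite /Nf; field.
  by rewrite !gt_eqF// addr_gt0.
have Nf0 : 0 < Nf.
  rewrite /Nf mulr_gt0 ?invr_gt0// mulr_gt0 ?divr_gt0 ?pi_gt0//.
  by rewrite addr_gt0// divr_gt0 ?exprn_gt0// mulr_gt0.
pose NG : R := (sin theta)^-1 *
  (pi / 2 * ((1 + d ^+ 2) / (2 * d) + 5 * b ^+ 2 / 2)
   - 8 / 3 * (cos theta * b * (1 - d)) / (d + 1)).
have GE : vsqnorm (half_guide theta) G = NG%:E.
  rewrite /vsqnorm; under eq_integral do rewrite EFinD.
  rewrite ge0_integralD//=; last 5 first.
  - exact: measurable_half_guide.
  - by move=> x _; rewrite lee_fin sqr_ge0.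
  - exact: measurable_sq_plane.
  - by move=> x _; rewrite lee_fin sqr_ge0.
  - exact: measurable_sq_plane.
  rewrite -!/(sqnorm _ _) /G1 /G2 !sqnorm_mode// -EFinD; congr EFin.
  rewrite /NG; have := cos2Dsin2 theta.
  move: (sin theta) s0 (cos theta) => S S0 C sc.
  have {}sc : C ^+ 2 = 1 - S ^+ 2 by rewrite -sc; ring.
  by field: sc; rewrite !gt_eqF// addr_gt0.
have NG_lt_Nf : NG < Nf.
  rewrite /NG /Nf ltr_pM2l ?invr_gt0// -subr_gt0.
  have cE : cos theta = 4 * b by rewrite /b; field.
  have b4 : b ^+ 2 <= 1 / 16 by have := cos_le1 theta; rewrite cE; nra.
  have pi4 : pi < 4 :> R by have := pihalf_lt2 R; lra.
  rewrite [X in 0 < X](_ : _ = b ^+ 2 / (1 + b ^+ 2) *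
     (32 / 3 * (1 - b ^+ 2) - 5 / 4 * pi * (1 + b ^+ 2))); last first.
    by rewrite cE /d; field; rewrite !gt_eqF// addr_gt0.
  (* With b^2 <= 1/16 and pi < 4, the last factor is at least
     32/3 * 15/16 - 5 * 17/16 > 0. *)
  apply: mulr_gt0; first by rewrite divr_gt0// addr_gt0.
  have p0 := pi_gt0 R; have := exprn_gt0 2 b0; nra.
have fH : inH1 (half_guide theta) f G by exact: inH1_mode.
apply: (@le_lt_trans _ _ (NG / Nf)%:E); last first.
  by rewrite lte_fin ltr_pdivrMr// mul1r.
apply: ereal_inf_lbound; exists f, G; split; last by rewrite fE GE.
split=> //.
- move=> f0; suff : Nf%:E = 0%E by move=> [] /eqP; rewrite gt_eqF.
  rewrite -fE /sqnorm (ae_eq_integral (cst 0%E)) ?integral0//.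
  + exact: measurable_half_guide.
  + exact: measurable_sq_plane.
  + apply: (@filterS _ _ (ae_filter_ringOfSetsType (leb2 R))) f0 => x f0x.
    by move=> /f0x /= ->; rewrite expr0n.
- by apply: has_dir_trace0 => // outer t; exact: mode_dir_line.
Qed.
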